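(* Every cancellative conjugation semigroup can be embedded in a group; that is, if $(S,+,\overline{(\;)})$ is a cancellative conjugation semigroup, then there exist a group $G$ and an injective semigroup homomorphism from $(S,+)$ to $G$.
   Context: A conjugation semigroup $(S,+,\overline{(\;)})$ is a semigroup $(S,+)$ (written additively but not assumed commutative) equipped with a unary operation $\overline{(\;)}\colon S\to S$ satisfying, for all $x,y\in S$: (1) $\overline{x}+x=x+\overline{x}$; (2) $x+\overline{y}+y=y+\overline{y}+x$; (3) $\overline{(x+y)}=\overline{y}+\overline{x}$. It is cancellative if its underlying semigroup is (left and right) cancellative. *)

(* Defs.v *)
From HB Require Import structures.
From mathcomp Require Import all_boot all_algebra.

Set Implicit Arguments.
Unset Strict Implicit.
Unset Printing Implicit Defensive.

Local Open Scope ring_scope.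

(* [addSemigroupType] is commutative and [semigroupType] carries a choice     *)
(* structure, so the noncommutative additive semigroups below are built       *)
(* directly on [baseAddMagmaType], whose carrier is an arbitrary (possibly    *)
(* empty) type.                                                               *)

HB.mixin Record isNCSemigroup S of Algebra.BaseAddMagma S := {
  ncaddA : associative (@Algebra.add S)
}.

#[short(type="ncSemigroupType")]
HB.structure Definition NCSemigroup :=
  {S of isNCSemigroup S & Algebra.BaseAddMagma S}.

HB.mixin Record isConjSemigroup S of NCSemigroup S := {
  bar : S -> S;
  bar_comm : forall x : S, bar x + x = x + bar x;
  bar_swap : forall x y : S, x + bar y + y = y + bar y + x;
  barD : forall x y : S, bar (x + y) = bar y + bar x
}.

#[short(type="conjSemigroupType")]
HB.structure Definition ConjSemigroup :=
  {S of isConjSemigroup S & NCSemigroup S}.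

(* [left_injective] gives x + z = y + z -> x = y, and [right_injective] gives *)
(* z + x = z + y -> x = y.                                                    *)
Definition cancellative (S : ncSemigroupType) : Prop :=
  left_injective (@Algebra.add S) /\ right_injective (@Algebra.add S).

(* Main.v *)
Require Import Defs.
From mathcomp Require Import all_boot all_algebra.
From HB Require Import structures.
From mathcomp Require Import perm generic_quotient boolp.

(** In a conjugation semigroup the norm [y + bar y] of every element is
central ([norm_central]) and the norm is additive ([normD]). So a cancellative
[S] can be localized at its norms exactly as in the commutative case: a
fraction is a class of pairs [(a, y)], thought of as the element [a] divided by
the norm of [y]. The conjugate then provides inverses, because [a + bar a] is
itself an admissible denominator: the inverse of [(a, y)] is
[(norm y + bar a, a)]. Hence the localization is already a group, and
[s |-> (s + norm s, s)] embeds [S] in it. Forming the identity [norm x0 / norm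
x0] takes an element [x0] of [S]; the empty semigroup embeds in any group. *)

Set Implicit Arguments.
Unset Strict Implicit.
Unset Printing Implicit Defensive.

Local Open Scope ring_scope.
Local Open Scope quotient_scope.

(** Locked, so that associativity does not split the sum hidden in a norm. *)
HB.lock Definition norm (S : conjSemigroupType) (y : S) : S := y + bar y.

Lemma add_bar (S : conjSemigroupType) (y : S) : y + bar y = norm y.
Proof. by rewrite norm.unlock. Qed.

(** This is the swap axiom, up to the regrouping allowed by [bar_comm]. *)
Lemma norm_central (S : conjSemigroupType) (x y : S) : norm y + x = x + norm y.
Proof. by rewrite -add_bar -bar_swap -ncaddA bar_comm add_bar. Qed.

Lemma normD (S : conjSemigroupType) (x y : S) : norm (x + y) = norm x + norm y.
Proof.
(* x + (y + bar y) + bar x, where the inner norm moves to the right. *)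
rewrite -[LHS]add_bar barD ncaddA -(ncaddA x) add_bar.
by rewrite -ncaddA (norm_central (bar x)) ncaddA add_bar.
Qed.

Section Fractions.

Variables (S : conjSemigroupType) (hS : cancellative S) (x0 : S).

Implicit Types (a b c x y z : S).

Let addIr z a b : a + z = b + z -> a = b.
Proof. exact: (proj1 hS). Qed.

Let addrI z a b : z + a = z + b -> a = b.
Proof. exact: (proj2 hS). Qed.

Let addnAC a y b : a + norm y + b = a + b + norm y.
Proof. by rewrite -!ncaddA norm_central. Qed.

Definition fraction_pair := {classic (S * S)}.

Definition fraction_eq : rel fraction_pair :=
  fun p q => `[<p.1 + norm q.2 = q.1 + norm p.2>].

Let fraction_eqP (p q : fraction_pair) :
  reflect (p.1 + norm q.2 = q.1 + norm p.2) (fraction_eq p q).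
Proof. exact: asboolP. Qed.

Lemma fraction_eq_refl : reflexive fraction_eq.
Proof. by move=> p; apply/fraction_eqP. Qed.

Lemma fraction_eq_sym : symmetric fraction_eq.
Proof. by move=> p q; apply/fraction_eqP/fraction_eqP. Qed.

Lemma fraction_eq_trans : transitive fraction_eq.
Proof.
move=> q p r /fraction_eqP pq /fraction_eqP qr; apply/fraction_eqP.
by apply: (@addIr (norm q.2)); rewrite addnAC pq addnAC qr addnAC.
Qed.

Canonical fraction_equiv :=
  EquivRel fraction_eq fraction_eq_refl fraction_eq_sym fraction_eq_trans.

Definition fractions := {eq_quot fraction_equiv}.

HB.instance Definition _ := Choice.on fractions.

Definition fraction a y : fractions := \pi_fractions ((a, y) : fraction_pair).

Lemma fractionP a y b z :
  a + norm z = b + norm y <-> fraction a y = fraction b z.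
Proof.
split=> [e|e]; first by apply/eqmodP/fraction_eqP.
by have /eqmodP/fraction_eqP := e.
Qed.

Lemma fractionW (P : fractions -> Prop) :
  (forall a y, P (fraction a y)) -> forall u, P u.
Proof. by move=> PP; elim/quotW => -[a y]; apply: PP. Qed.

Definition fraction_one : fractions := fraction (norm x0) x0.

Definition fraction_mul (u v : fractions) : fractions :=
  fraction ((repr u).1 + (repr v).1) ((repr u).2 + (repr v).2).

Definition fraction_inv (u : fractions) : fractions :=
  fraction (norm (repr u).2 + bar (repr u).1) (repr u).1.

Let repr_fraction a y :
  (repr (fraction a y)).1 + norm y = a + norm (repr (fraction a y)).2.
Proof.
by apply/fractionP; rewrite /fraction -surjective_pairing reprK.
Qed.

Lemma fraction_mulE a y b z :
  fraction_mul (fraction a y) (fraction b z) = fraction (a + b) (y + z).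
Proof.
apply/fractionP; have := repr_fraction a y; have := repr_fraction b z.
case: (repr _) => b' z' /= eb; case: (repr _) => a' y' /= ea.
rewrite !normD !ncaddA -(addnAC a') ea -!ncaddA; congr (_ + _).
by rewrite eb !ncaddA norm_central.
Qed.

(** Conjugation need not be involutive, nor preserve norms, so applying [bar] to
an equality of fractions is of no use here: the equality is used only after
adding a numerator, which turns [bar] into a norm. *)
Lemma fraction_invE a y :
  fraction_inv (fraction a y) = fraction (norm y + bar a) a.
Proof.
apply/fractionP; have := repr_fraction a y; case: (repr _) => b z /= e.
(* Adding [b] on the left turns both sides into [norm a + norm b + norm z],
   the right one thanks to [e]. *)
apply: (@addrI b); rewrite !ncaddA e.
rewrite [b + _ + _]addnAC [a + _ + _]addnAC !add_bar [LHS]addnAC [RHS]addnAC.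
by rewrite norm_central.
Qed.

Lemma fraction_mulA : associative fraction_mul.
Proof.
elim/fractionW => a x; elim/fractionW => b y; elim/fractionW => c z.
by rewrite !fraction_mulE !ncaddA.
Qed.

Lemma fraction_mul1 : left_id fraction_one fraction_mul.
Proof.
elim/fractionW => a x; rewrite fraction_mulE; apply/fractionP.
by rewrite normD norm_central ncaddA.
Qed.

Lemma fraction_mulr1 : right_id fraction_one fraction_mul.
Proof.
elim/fractionW => a x; rewrite fraction_mulE; apply/fractionP.
by rewrite normD ncaddA addnAC.
Qed.

Lemma fraction_mulV : left_inverse fraction_one fraction_inv fraction_mul.
Proof.
elim/fractionW => a x; rewrite fraction_invE fraction_mulE; apply/fractionP.
rewrite -[_ + a]ncaddA bar_comm add_bar normD norm_central.
by rewrite [norm x + _]norm_central.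
Qed.

Lemma fraction_mulrV : right_inverse fraction_one fraction_inv fraction_mul.
Proof.
elim/fractionW => a x; rewrite fraction_invE fraction_mulE; apply/fractionP.
rewrite ncaddA addnAC add_bar [RHS]norm_central normD.
by rewrite (norm_central (norm a)).
Qed.

(** Packed by hand: the identity mentions [x0], which the type [fractions] does
not determine. *)
Definition fraction_group : groupType :=
  HB.pack fractions (isGroup.Build fractions
    fraction_mulA fraction_mul1 fraction_mulr1 fraction_mulV fraction_mulrV).

(** [s] is represented by [(s + norm s) / norm s], which needs no choice of a
denominator and is additive in [s] already at the level of pairs. *)
Definition fraction_embed (s : S) : fraction_group := fraction (s + norm s) s.

Lemma fraction_embed_inj : injective fraction_embed.
Proof.
move=> s t /fractionP; rewrite addnAC.
by move=> /addIr /addIr.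
Qed.

Lemma fraction_embedD :
  {morph fraction_embed : s t / s + t >-> (s * t)%g}.
Proof.
move=> s t; rewrite [RHS]fraction_mulE /fraction_embed normD.
by rewrite !ncaddA (addnAC s s t).
Qed.

End Fractions.

Theorem mainTheorem2 (S : conjSemigroupType) (hS : cancellative S) :
  exists (G : groupType) (f : S -> G),
    injective f /\ {morph f : x y / x + y >-> (x * y)%g}.
Proof.
have [[x0]|S0] := EM (inhabited S).
  exists (fraction_group hS x0), (fraction_embed hS x0).
  by split; [exact: fraction_embed_inj|exact: fraction_embedD].
exists {perm void}, (fun=> 1%g).
by split=> x; case: S0.
Qed.
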